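(* Let $L$ be recognized by a Streett automaton with costs $\mathcal{A}$ over an alphabet $\Sigma_I\times\Sigma_O$ with $n$ states and $k$ Streett pairs, and let $f$ be the constant delay function with $f(0)=2^{n^4 2^{3k}+1}$. Then the following are equivalent: (1) Player $I$ wins $\Gamma_f(L(\mathcal{A}))$; (2) Player $I$ wins $\Gamma_{f'}(L(\mathcal{A}))$ for every delay function $f'$.
   Context: A Streett automaton with costs is a tuple $\mathcal{A}=(Q,\Sigma,q_I,\delta,(Q_j,P_j)_{j\in J},(\mathrm{Cst}_j)_{j\in J})$ with a finite set $Q$ of states, a finite alphabet $\Sigma$, an initial state $q_I$, a deterministic complete transition function $\delta\colon Q\times\Sigma\to Q$, a finite family of Streett pairs $(Q_j,P_j)$ with $Q_j,P_j\subseteq Q$ (states in $Q_j$ are requests of pair $j$, states in $P_j$ responses), and for each $j\in J$ a cost function $\mathrm{Cst}_j$ assigning to every transition $(q,a,\delta(q,a))$ either $\epsilon$ or $\mathtt{i}$. The number of Streett pairs is $|J|$. The run on $a_0a_1\cdots$ is $\rho=(q_0,a_0,q_1)(q_1,a_1,q_2)\cdots$ with $q_0=q_I$, $q_{m+1}=\delta(q_m,a_m)$. For position $n$, $\mathrm{StCor}_j(\rho,n)=0$ if $q_n\notin Q_j$, and otherwise it is the minimum, over all $n'\ge n$ with $q_{n'}\in P_j$, of the number of transitions among $(q_n,a_n,q_{n+1})\cdots(q_{n'-1},a_{n'-1},q_{n'})$ that $\mathrm{Cst}_j$ maps to $\mathtt{i}$ ($\min\emptyset=\infty$). Let $\mathrm{StCor}(\rho,n)=\max_{j\in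 J}\mathrm{StCor}_j(\rho,n)$. The run is accepting if $\limsup_{n\to\infty}\mathrm{StCor}(\rho,n)<\infty$, and $L(\mathcal{A})$ is the set of infinite words whose run is accepting. A delay function is a map $f\colon\mathbb{N}\to\mathbb{N}\setminus\{0\}$; it is constant if $f(i)=1$ for every $i>0$. For $L\subseteq(\Sigma_I\times\Sigma_O)^\omega$, the delay game $\Gamma_f(L)$ is played in rounds $i=0,1,2,\ldots$: in round $i$, Player $I$ picks $u_i\in\Sigma_I^{f(i)}$, then Player $O$ picks $v_i\in\Sigma_O$. Player $O$ wins the play if the outcome, i.e., the word over $\Sigma_I\times\Sigma_O$ pairing $u_0u_1u_2\cdots$ and $v_0v_1v_2\cdots$ letterwise, is in $L$; otherwise Player $I$ wins. A strategy for Player $I$ is a map $\tau_I\colon\Sigma_O^*\to\Sigma_I^*$ with $|\tau_I(w)|=f(|w|)$; a strategy for Player $O$ is a map $\tau_O\colon\Sigma_I^*\to\Sigma_O$. A play is consistent with $\tau_I$ if $u_i=\tau_I(v_0\cdots v_{i-1})$ for all $i$, and with $\tau_O$ if $v_i=\tau_O(u_0\cdots u_i)$ for all $i$. A strategy is winning if every consistent play is won by its owner; a player wins the game if she has a winning strategy. *)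

(* Defs.v *)
From mathcomp Require Import all_boot all_order.
Set Implicit Arguments. Unset Strict Implicit. Unset Printing Implicit Defensive.

Record streett_cost (SigmaI SigmaO Q J : finType) := StreettCost {
  qI : Q;
  delta : Q -> (SigmaI * SigmaO) -> Q;
  reqs : J -> {set Q};
  resps : J -> {set Q};
  cost : J -> Q -> (SigmaI * SigmaO) -> bool
    (* Cst_j (q, a, delta q a) = i  iff  cost j q a = true; otherwise epsilon *)
}.

Section Defs.
Variables (SigmaI SigmaO Q J : finType).
Variable A : streett_cost SigmaI SigmaO Q J.

Fixpoint run_state (w : nat -> SigmaI * SigmaO) (m : nat) : Q :=
  match m with
  | 0 => qI A
  | m'.+1 => delta A (run_state w m') (w m')
  end.

Definition cost_count (w : nat -> SigmaI * SigmaO) (j : J) (n n' : nat) : nat :=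
  count (fun m => cost A j (run_state w m) (w m)) (iota n (n' - n)).

(* StCor_j(rho, n) <= b, i.e. the unfolding of:
   StCor_j = 0 if q_n \notin Q_j, else min over n' >= n with q_n' \in P_j of
   cost_count (min of empty set = infinity). *)
Definition stcor_j_le (w : nat -> SigmaI * SigmaO) (j : J) (n b : nat) : Prop :=
  run_state w n \notin reqs A j \/
  exists n', n <= n' /\ run_state w n' \in resps A j /\ cost_count w j n n' <= b.

(* StCor(rho, n) = max_j StCor_j(rho, n) <= b *)
Definition stcor_le (w : nat -> SigmaI * SigmaO) (n b : nat) : Prop :=
  forall j : J, stcor_j_le w j n b.

(* limsup_n StCor(rho, n) < infinity *)
Definition accepting (w : nat -> SigmaI * SigmaO) : Prop :=
  exists b N, forall n, N <= n -> stcor_le w n b.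

Definition lang : (nat -> SigmaI * SigmaO) -> Prop := accepting.
End Defs.

Definition delay_fun (f : nat -> nat) : Prop := forall i, 0 < f i.
Definition constant_delay (f : nat -> nat) : Prop :=
  delay_fun f /\ forall i, 0 < i -> f i = 1.

Section Game.
Variables (SigmaI SigmaO : Type).

Definition block_start (f : nat -> nat) (i : nat) : nat := \sum_(j < i) f j.

(* A play is represented by the infinite input word x = u_0 u_1 ... and the
   output word y = v_0 v_1 ...; u_i = x[block_start i, block_start (i+1)). *)
Definition block (f : nat -> nat) (x : nat -> SigmaI) (i : nat) : seq SigmaI :=
  [seq x p | p <- iota (block_start f i) (f i)].

Definition in_prefix (f : nat -> nat) (x : nat -> SigmaI) (i : nat) : seq SigmaI :=
  [seq x p | p <- iota 0 (block_start f i.+1)].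

Definition out_prefix (y : nat -> SigmaO) (i : nat) : seq SigmaO :=
  [seq y p | p <- iota 0 i].

Definition strategyI (f : nat -> nat) (tau : seq SigmaO -> seq SigmaI) : Prop :=
  forall w, size (tau w) = f (size w).

Definition consistentI (f : nat -> nat) (tau : seq SigmaO -> seq SigmaI)
  (x : nat -> SigmaI) (y : nat -> SigmaO) : Prop :=
  forall i, block f x i = tau (out_prefix y i).

Definition consistentO (f : nat -> nat) (tau : seq SigmaI -> SigmaO)
  (x : nat -> SigmaI) (y : nat -> SigmaO) : Prop :=
  forall i, y i = tau (in_prefix f x i).

Definition outcome (x : nat -> SigmaI) (y : nat -> SigmaO) : nat -> SigmaI * SigmaO :=
  fun p => (x p, y p).

Definition playerI_wins (f : nat -> nat) (L : (nat -> SigmaI * SigmaO) -> Prop) : Prop :=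
  exists tau, strategyI f tau /\
    forall x y, consistentI f tau x y -> ~ L (outcome x y).
End Game.

(* Main.v *)
(** Write [f 0 = 2 d]. In [Gamma_f] Player I always is two blocks of [d]
    letters ahead of Player O. Summarize an input word [u] by the set of
    [(q, t)] such that some output word of the same length leads from [q] to
    the end state and the three flags per Streett pair recorded in [t]. There
    are at most [d] summaries and they form a right congruence, so a block of
    length [d] has two prefixes with equal summaries and can be pumped to
    arbitrarily long words with the same summary.

    Player I wins [Gamma_f'] by simulating a play of [Gamma_f] and playing
    pumped versions of its blocks, each so long that the lookahead granted by
    [f'] is used up; equality of summaries translates Player O's answer to a
    pumped block into an answer to the original one with the same effect.
    If the pumped play were accepting, then so would be the simulated one:
    a response in it is reached after the same number of costly blocks, each
    of which contributes at least 1 to the cost in the pumped play and at most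
    [d] to the cost in the simulated play. *)

Require Import Defs.
From mathcomp Require Import all_boot all_order.
Set Implicit Arguments. Unset Strict Implicit. Unset Printing Implicit Defensive.

(** * Finite infixes of infinite words *)

Definition segment (T : Type) (w : nat -> T) (p p' : nat) : seq T :=
  [seq w r | r <- iota p (p' - p)].

Lemma size_segment (T : Type) (w : nat -> T) p p' : size (segment w p p') = p' - p.
Proof. by rewrite size_map size_iota. Qed.

Lemma segmentS (T : Type) (w : nat -> T) p p' :
  p <= p' -> segment w p p'.+1 = rcons (segment w p p') (w p').
Proof.
move=> le_pp'; rewrite /segment subSn // -addn1 iotaD map_cat /= subnKC //.
by rewrite cats1.
Qed.

Lemma segment_nil (T : Type) (w : nat -> T) p : segment w p p = [::].
Proof. by rewrite /segment subnn. Qed.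

Lemma nth_segment (T : Type) (x0 : T) (w : nat -> T) p p' r :
  r < p' - p -> nth x0 (segment w p p') r = w (p + r).
Proof. by move=> lt_r; rewrite (nth_map 0) ?size_iota // nth_iota. Qed.

Lemma eq_segment (T : Type) (w w' : nat -> T) p p' :
  (forall r, p <= r < p' -> w r = w' r) -> segment w p p' = segment w' p p'.
Proof.
move=> eq_w; apply/eq_in_map => r; rewrite mem_iota => /andP[le_pr lt_r].
apply: eq_w; rewrite le_pr /=; case: (leqP p p') => [le_pp'|/ltnW le_p'p].
  by rewrite subnKC in lt_r.
by rewrite (eqP le_p'p) addn0 ltnNge le_pr in lt_r.
Qed.

Lemma segment_zip (T U : Type) (x : nat -> T) (y : nat -> U) p p' :
  segment (outcome x y) p p' = zip (segment x p p') (segment y p p').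
Proof. by rewrite /segment; elim: (iota p _) => //= r s ->. Qed.

(** * Division of the positions into consecutive nonempty blocks *)

Section Partition.
Variable s : nat -> nat.
Hypotheses (s0 : s 0 = 0) (s_lt : forall i, s i < s i.+1).

Lemma partition_mono i k : i <= k -> s i <= s k.
Proof.
elim: k => [|k IHk]; first by rewrite leqn0 => /eqP->.
rewrite leq_eqVlt => /predU1P[-> // | /IHk le_ik].
exact: leq_trans le_ik (ltnW (s_lt k)).
Qed.

Lemma partition_ge i : i <= s i.
Proof. by elim: i => // i IHi; apply: leq_ltn_trans IHi (s_lt i). Qed.

Lemma partition_block p : exists i, s i <= p < s i.+1.
Proof.
have ex_i: exists i, p < s i.+1 by exists p; apply: partition_ge.
case: (ex_minnP ex_i) => i lt_p min_i; exists i; rewrite lt_p andbT.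
case: i lt_p min_i => [|i] lt_p min_i; first by rewrite s0.
by rewrite leqNgt; apply/negP => /min_i; rewrite ltnn.
Qed.

End Partition.

(** * Pumping for right congruences of finite index *)

Section Pumping.
Variables (T : Type) (F : finType) (h : seq T -> F).
Hypothesis h_congr : forall u u' w, h u = h u' -> h (u ++ w) = h (u' ++ w).

(** The [size u + 1] prefixes of [u] outnumber the values of [h], so two of them agree under [h]; by
    congruence, the factor between them can be repeated [M] times. *)
Lemma pumping (u : seq T) (M : nat) :
  #|F| <= size u -> exists u', M <= size u' /\ h u' = h u.
Proof.
move=> le_Fu; pose g (i : 'I_(size u).+1) := h (take i u).
have /injectivePn[i [k neq_ik eq_g]]: ~~ injectiveb g.
  apply/negP => /injectiveP/leq_card.
  by rewrite card_ord leqNgt ltnS le_Fu.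
wlog lt_ik: i k neq_ik eq_g / i < k => [IH|].
  case: (ltngtP i k) => [|/IH|/val_inj eq_ik]; first exact: IH.
  - by apply; rewrite // eq_sym.
  by rewrite eq_ik eqxx in neq_ik.
have le_ku: k <= size u by rewrite -ltnS ltn_ord.
pose a := take i u; pose b := drop i (take k u); pose c := drop k u.
have Da: a = take i (take k u) by rewrite take_takel // ltnW.
have Du: u = a ++ b ++ c by rewrite catA Da !cat_take_drop.
have h_ab: h (a ++ b) = h a by rewrite {1}Da cat_take_drop; apply/esym.
have h_abn m : h (a ++ flatten (nseq m b)) = h a.
  elim: m => [|m IHm]; first by rewrite cats0.
  by rewrite /= catA (h_congr _ h_ab).
exists ((a ++ flatten (nseq M b)) ++ c); split; last first.
  by rewrite (h_congr _ (h_abn M)) Du catA (h_congr _ h_ab).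
rewrite !size_cat size_flatten /shape map_nseq sumn_nseq.
have b_gt0: 0 < size b by rewrite size_drop size_takel // subn_gt0.
by rewrite addnAC (leq_trans (leq_pmull M b_gt0)) // leq_addl.
Qed.

End Pumping.

(** * Strategies of Player I as causal maps on infinite words *)

Section Strategies.
Variables SigmaI SigmaO : Type.

(** The input letters picked up to round [r] may depend on the first [r] output letters only. *)
Definition causal (f : nat -> nat)
    (X : (nat -> SigmaO) -> nat -> SigmaI) : Prop :=
  forall r y y', (forall p, p < r -> y p = y' p) ->
  forall p, p < block_start f r.+1 -> X y p = X y' p.

Variables (f : nat -> nat) (L : (nat -> SigmaI * SigmaO) -> Prop).
Hypothesis f_gt0 : delay_fun f.

Lemma block_start0 (g : nat -> nat) : block_start g 0 = 0.
Proof. exact: big_ord0. Qed.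

Lemma block_startS (g : nat -> nat) i : block_start g i.+1 = block_start g i + g i.
Proof. exact: big_ord_recr. Qed.

Lemma block_start_lt i : block_start f i < block_start f i.+1.
Proof. by rewrite block_startS -addn1 leq_add2l f_gt0. Qed.

Lemma playerI_wins_causal :
    inhabited SigmaO -> playerI_wins f L ->
  exists2 X, causal f X & forall y, ~ L (outcome (X y) y).
Proof.
move=> [o0] [tau [tauP winP]].
have [x0]: inhabited SigmaI.
  have := f_gt0 0; have := tauP [::].
  by case: (tau _) => [/= <- // | x _ _ _]; exists.
pose G y m := flatten [seq tau (out_prefix y i) | i <- iota 0 m].
have GS y m : G y m.+1 = G y m ++ tau (out_prefix y m).
  by rewrite /G -addn1 iotaD map_cat flatten_cat /= cats0.
have sizeG y m : size (G y m) = block_start f m.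
  elim: m => [|m IHm]; first by rewrite block_start0.
  by rewrite GS size_cat IHm tauP block_startS size_map size_iota.
have nthG y m k p : m <= k -> p < block_start f m ->
    nth x0 (G y k) p = nth x0 (G y m) p.
  move=> le_mk lt_p; elim: k le_mk => [|k IHk].
    by rewrite leqn0 => /eqP->.
  rewrite leq_eqVlt => /predU1P[-> // | lt_mk].
  rewrite GS nth_cat sizeG (leq_trans lt_p) ?IHk //.
  exact: (partition_mono block_start_lt).
(* Blocks are nonempty, so the first [p.+1] blocks contain position [p]. *)
pose X y p := nth x0 (G y p.+1) p.
have XE y m p : p < block_start f m -> X y p = nth x0 (G y m) p.
  move=> lt_p; rewrite /X; case/orP: (leq_total p.+1 m) => [le_pm|le_mp].
    rewrite [RHS](nthG _ p.+1) //.
    exact: (partition_ge block_start_lt p.+1).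
  exact: nthG.
exists X => [r y y' eq_y p lt_p | y]; last first.
  apply: winP => i; apply: (@eq_from_nth _ x0).
    by rewrite tauP !size_map !size_iota.
  move=> p; rewrite size_map size_iota => lt_p.
  rewrite (nth_map 0) ?size_iota // nth_iota // (XE y i.+1).
    by rewrite GS nth_cat sizeG ltnNge leq_addr /= addKn.
  by rewrite block_startS ltn_add2l.
rewrite !(XE _ r.+1) // /G; congr (nth _ (flatten _) _).
apply/eq_in_map => i; rewrite mem_iota add0n ltnS => /andP[_ le_ir].
congr tau; apply/eq_in_map => q; rewrite mem_iota add0n => /andP[_ lt_qi].
by apply: eq_y; apply: leq_trans lt_qi le_ir.
Qed.

(** The strategy reads its next block off [X], applied to the finite output padded with [o0]; by
    causality the padding has no influence. *)
Lemma causal_playerI_wins (o0 : SigmaO) (X : (nat -> SigmaO) -> nat -> SigmaI) :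
    causal f X -> (forall x y, x =1 X y -> ~ L (outcome x y)) ->
  playerI_wins f L.
Proof.
move=> causalX winX.
exists (fun v => block f (X (nth o0 v)) (size v)); split=> [v|x y cons_xy].
  by rewrite size_map size_iota.
apply: winX => p.
have [i /andP[le_ip lt_pi]] :=
  partition_block (block_start0 f) block_start_lt p.
have sz_i: size (out_prefix y i) = i by rewrite size_map size_iota.
have lt_p: p - block_start f i < f i by rewrite ltn_subLR // -block_startS.
have := congr1 (fun u => nth (x p) u (p - block_start f i)) (cons_xy i).
rewrite /= sz_i !(nth_map 0) ?size_iota // nth_iota // subnKC // => ->.
apply: (causalX i) => // q lt_qi.
by rewrite (nth_map 0) ?size_iota // nth_iota.
Qed.

End Strategies.

(** * Flags and costs along run infixes *)

Section Tracking.
Variables (SigmaI SigmaO Q J : finType) (A : streett_cost SigmaI SigmaO Q J).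
Implicit Types w : nat -> SigmaI * SigmaO.

(* Flags of a pair along a run infix: some request is still pending, some
   response occurred, some cost was incurred. *)
Definition tracked := (Q * {ffun J -> bool * bool * bool})%type.

Definition track0 (q : Q) : tracked := (q, [ffun=> (false, false, false)]).

(** The flags are updated with the state being left, so an infix covers its first position but not
    its end. A response answers a request at the same position. *)
Definition track (t : tracked) (a : SigmaI * SigmaO) : tracked :=
  (delta A t.1 a,
   [ffun j => ((((t.2 j).1.1 || (t.1 \in reqs A j)) && (t.1 \notin resps A j),
                (t.2 j).1.2 || (t.1 \in resps A j)),
               (t.2 j).2 || cost A j t.1 a)]).

Definition track_run w p p' : tracked :=
  foldl track (track0 (run_state A w p)) (segment w p p').

Definition pending w p p' j := ((track_run w p p').2 j).1.1.
Definition answered w p p' j := ((track_run w p p').2 j).1.2.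
Definition costly w p p' j := ((track_run w p p').2 j).2.

Lemma track_runS w p p' : p <= p' ->
  track_run w p p'.+1 = track (track_run w p p') (w p').
Proof. by move=> le_pp'; rewrite /track_run segmentS // foldl_rcons. Qed.

Lemma track_run_state w p p' : p <= p' -> (track_run w p p').1 = run_state A w p'.
Proof.
move/subnK <-; elim: (p' - p) => [|l IHl].
  by rewrite add0n /track_run segment_nil.
by rewrite addSn track_runS ?leq_addl //= IHl.
Qed.

Lemma pendingP w p p' j : p <= p' ->
  reflect (exists r, [/\ p <= r < p', run_state A w r \in reqs A j &
             forall r', r <= r' < p' -> run_state A w r' \notin resps A j])
          (pending w p p' j).
Proof.
move/subnK <-; elim: (p' - p) => [|l IHl].
  rewrite add0n /pending /track_run segment_nil /= ffunE.
  by right=> -[r [/andP[le_pr]]]; rewrite ltnNge le_pr.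
rewrite addSn /pending track_runS ?leq_addl //= ffunE /= track_run_state ?leq_addl //.
apply: (iffP andP) => [[/orP[/IHl[r [/andP[le_pr lt_r] req_r nr]]|req_r] nresp] |].
- exists r; split; rewrite ?le_pr ?ltnS 1?ltnW // => r' /andP[le_r].
  rewrite ltnS leq_eqVlt => /predU1P[-> // | lt_r'].
  by apply: nr; rewrite le_r.
- exists (l + p); split; rewrite ?leq_addl ?ltnS ?leqnn // => r'.
  by rewrite ltnS -eqn_leq => /eqP <-.
case=> r [/andP[le_pr]]; rewrite ltnS leq_eqVlt => lt_r req_r nr; split; last first.
  by apply: nr; rewrite ltnS leqnn andbT leq_eqVlt.
case/predU1P: lt_r => [<- | lt_r]; first by rewrite req_r orbT.
apply/orP; left; apply/IHl; exists r; split; rewrite ?le_pr // => r' /andP[le_r lt_r'].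
by apply: nr; rewrite le_r ltnS ltnW.
Qed.

Lemma answeredP w p p' j : p <= p' ->
  reflect (exists2 r, p <= r < p' & run_state A w r \in resps A j)
          (answered w p p' j).
Proof.
move/subnK <-; elim: (p' - p) => [|l IHl].
  rewrite add0n /answered /track_run segment_nil /= ffunE.
  by right=> -[r /andP[le_pr]]; rewrite ltnNge le_pr.
rewrite addSn /answered track_runS ?leq_addl //= ffunE /= track_run_state ?leq_addl //.
apply: (iffP orP) => [[/IHl[r /andP[le_pr lt_r] resp_r] | resp_r] |].
- by exists r; rewrite // le_pr ltnS ltnW.
- by exists (l + p); rewrite // leq_addl ltnS leqnn.
case=> r /andP[le_pr]; rewrite ltnS leq_eqVlt => /predU1P[-> | lt_r]; first by right.
by move=> resp_r; left; apply/IHl; exists r; rewrite // le_pr.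
Qed.

Lemma cost_count_cat w j p r p' : p <= r <= p' ->
  cost_count A w j p p' = cost_count A w j p r + cost_count A w j r p'.
Proof.
case/andP=> le_pr le_rp'; rewrite /cost_count -count_cat.
rewrite -{2}(subnKC le_pr) -iotaD; congr (count _ (iota _ _)).
by rewrite addnC addnBA // subnK.
Qed.

Lemma cost_count_mono w j p1 p2 p3 p4 : p1 <= p2 -> p2 <= p3 -> p3 <= p4 ->
  cost_count A w j p2 p3 <= cost_count A w j p1 p4.
Proof.
move=> le12 le23 le34; rewrite (@cost_count_cat w j p1 p2 p4).
  by rewrite (@cost_count_cat w j p2 p3 p4) ?le23 // addnCA leq_addr.
by rewrite le12 (leq_trans le23).
Qed.

Lemma cost_count_size w j p p' : cost_count A w j p p' <= p' - p.
Proof. by rewrite /cost_count (leq_trans (count_size _ _)) // size_iota. Qed.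

Lemma costlyE w p p' j : p <= p' -> costly w p p' j = (0 < cost_count A w j p p').
Proof.
move/subnK <-; elim: (p' - p) => [|l IHl].
  by rewrite add0n /costly /track_run segment_nil /= ffunE /cost_count subnn.
rewrite addSn /costly track_runS ?leq_addl //= ffunE /= track_run_state ?leq_addl //.
rewrite (@cost_count_cat w j p (l + p) (l + p).+1) ?leq_addl ?leqnSn //.
rewrite addn_gt0 -IHl; congr (_ || _).
by rewrite /cost_count subSnn /=; case: cost.
Qed.

(** * Cost of a run infix against its number of costly blocks *)

Section Blocks.
Variables (w : nat -> SigmaI * SigmaO) (s : nat -> nat) (j : J).
Hypothesis s_lt : forall i, s i < s i.+1.

Let costly_block i := costly w (s i) (s i.+1) j.

Lemma costly_blocks_le i k : i <= k ->
  count costly_block (iota i (k - i)) <= cost_count A w j (s i) (s k).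
Proof.
move/subnK <-; rewrite addnK; elim: (k - i) => [|l IHl] //.
rewrite -[in iota _ _]addn1 iotaD count_cat /= addn0 addSn.
rewrite (@cost_count_cat w j (s i) (s (l + i)) (s (l + i).+1)).
  by rewrite leq_add // addnC /costly_block costlyE ?(ltnW (s_lt _)) //; case: cost_count.
by rewrite (partition_mono s_lt) ?leq_addl // ltnW.
Qed.

Lemma cost_count_blocks d i k : (forall m, s m.+1 <= s m + d) -> i <= k ->
  cost_count A w j (s i) (s k) <= d * count costly_block (iota i (k - i)).
Proof.
move=> s_le; move/subnK <-; rewrite addnK; elim: (k - i) => [|l IHl].
  by rewrite add0n /cost_count subnn.
rewrite -[in iota _ _]addn1 iotaD count_cat /= addn0 addSn.
rewrite (@cost_count_cat w j (s i) (s (l + i)) (s (l + i).+1)); last first.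
  by rewrite (partition_mono s_lt) ?leq_addl // ltnW.
rewrite mulnDr leq_add // addnC /costly_block costlyE ?(ltnW (s_lt _)) //.
case: posnP => [-> // | _]; rewrite muln1 (leq_trans (cost_count_size _ _ _ _)) //.
by rewrite leq_subLR.
Qed.

End Blocks.

(* Bounded blocks are needed on the side of [w] only: the cost of a request
   in [w] is controlled by the number of costly blocks until its response, and
   each of these contributes to the cost of a request of [w'] in the same
   block, however long the blocks of [w'] are. *)
Lemma accepting_transfer w w' (s s' : nat -> nat) d :
    s 0 = 0 -> (forall i, s i < s i.+1) -> (forall i, s i.+1 <= s i + d) ->
    s' 0 = 0 -> (forall i, s' i < s' i.+1) ->
    (forall i, track_run w (s i) (s i.+1) = track_run w' (s' i) (s' i.+1)) ->
  accepting A w' -> accepting A w.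
Proof.
move=> s0 s_lt s_le s'0 s'_lt eq_ww' [b [N acc_w']].
(* At most [b] costly blocks lie strictly between those of request and response; these two add 2,
   and a block costs at most [d]. Starting at [s N] makes the block index, and hence the positions
   of that block in [w'], at least [N]. *)
exists (d * b.+2), (s N) => p le_sNp j.
have [req_p | ?] := boolP (run_state A w p \in reqs A j); [right | by left].
have [i /andP[le_ip lt_pi]] := partition_block s0 s_lt p.
have le_Ni: N <= i.
  rewrite leqNgt; apply/negP => /(partition_mono s_lt) le_i.
  by move: (leq_ltn_trans (leq_trans le_i le_sNp) lt_pi); rewrite ltnn.
(* A response within the block of [p] costs at most [d]. Otherwise the request is pending at the end
   of the block, which the flags carry over to [w']. *)
have [[r /andP[le_pr lt_r] resp_r] | nresp] := @answeredP w p (s i.+1) j (ltnW lt_pi).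
  exists r; do 2!split=> //; rewrite (leq_trans (cost_count_size _ _ _ _)) //.
  rewrite (@leq_trans d) ?leq_pmulr // leq_subLR (leq_trans (ltnW lt_r)) //.
  by rewrite (leq_trans (s_le i)) // leq_add2r.
have pend_i: pending w (s i) (s i.+1) j.
  apply/pendingP; first exact: ltnW.
  exists p; split=> [||r /andP[le_pr lt_r]]; rewrite ?le_ip //.
  by apply/negP=> resp_r; case: nresp; exists r; rewrite // le_pr.
move: pend_i; rewrite /pending eq_ww'.
case/(pendingP _ _ (ltnW (s'_lt i))) => p' [/andP[le_ip' lt_p'i] req_p' nresp'].
have le_Np': N <= p'.
  by rewrite (leq_trans _ le_ip') // (leq_trans le_Ni) ?partition_ge.
have [|[n' [le_p'n' [resp_n' cost_n']]]] := acc_w' p' le_Np' j; first by rewrite req_p'.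
have [k /andP[le_kn' lt_n'k]] := partition_block s'0 s'_lt n'.
have lt_ik: i < k.
  rewrite ltnNge; apply/negP => le_ki.
  suff: run_state A w' n' \notin resps A j by rewrite resp_n'.
  by apply: nresp'; rewrite le_p'n' (leq_trans lt_n'k) ?(partition_mono s'_lt).
have: answered w (s k) (s k.+1) j.
  rewrite /answered eq_ww'; apply/answeredP; first exact: ltnW.
  by exists n'; rewrite // le_kn'.
case/(answeredP _ _ (ltnW (s_lt k))) => r /andP[le_kr lt_rk] resp_r.
have le_pr: p <= r.
  by rewrite (leq_trans (ltnW lt_pi)) // (leq_trans _ le_kr) ?(partition_mono s_lt).
exists r; do 2!split=> //.
apply: leq_trans (cost_count_mono w j le_ip le_pr (ltnW lt_rk)) _.
apply: leq_trans (cost_count_blocks w j s_lt s_le (ltnW (leqW lt_ik))) _.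
rewrite leq_mul2l; apply/orP; right.
(* The blocks strictly between [i] and [k] lie inside the stretch from [p'] to [n'], whose cost is
   at most [b]. *)
have ->: k.+1 - i = 1 + ((k - i.+1) + 1).
  by rewrite addn1 add1n subnSK // subSn // ltnW.
rewrite !iotaD !count_cat /= addn1 subnKC // !addn0.
rewrite -[b.+2]add1n -[b.+1]addn1 !leq_add ?leq_b1 //.
apply: leq_trans cost_n'.
rewrite (eq_count (a2 := fun m => costly w' (s' m) (s' m.+1) j)); last first.
  by move=> m; rewrite /costly eq_ww'.
apply: leq_trans (costly_blocks_le w' j s'_lt lt_ik) _.
by apply: cost_count_mono; rewrite ?(ltnW lt_p'i) ?(partition_mono s'_lt).
Qed.

(** * Summaries of input words and their number *)

Definition summary (u : seq SigmaI) : {set Q * tracked} :=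
  [set qt | [exists v : (size u).-tuple SigmaO,
               foldl track (track0 qt.1) (zip u v) == qt.2]].

Lemma summaryP u q t :
  reflect (exists2 v, size v = size u & foldl track (track0 q) (zip u v) = t)
          ((q, t) \in summary u).
Proof.
rewrite inE /=; apply: (iffP existsP) => [[v /eqP <-] | [v sz_v <-]].
  by exists v; rewrite ?size_tuple.
by exists (tcast sz_v (in_tuple v)); rewrite val_tcast.
Qed.

(** Only the part of the output word facing [u] has to be exchanged, for one facing [u'] with the
    same effect. *)
Lemma summary_cat u u' x :
  summary u = summary u' -> summary (u ++ x) = summary (u' ++ x).
Proof.
suff sub u1 u2 : summary u1 = summary u2 ->
    {subset summary (u1 ++ x) <= summary (u2 ++ x)}.
  by move=> eq_u; apply/eqP; rewrite eqEsubset; apply/andP; split;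
    apply/subsetP; apply: sub.
move=> eq_u [q t] /summaryP[v]; rewrite size_cat => sz_v <-.
have sz_v1: size (take (size u1) v) = size u1.
  by rewrite size_takel // sz_v leq_addr.
rewrite -(cat_take_drop (size u1) v) zip_cat // foldl_cat.
set t1 := foldl _ _ (zip u1 _).
have: (q, t1) \in summary u1 by apply/summaryP; exists (take (size u1) v).
rewrite eq_u => /summaryP[v2 sz_v2 <-].
apply/summaryP; exists (v2 ++ drop (size u1) v).
  by rewrite !size_cat sz_v2 size_drop sz_v addKn.
by rewrite zip_cat // foldl_cat.
Qed.

Lemma card_summary : #|{set Q * tracked}| = 2 ^ (#|Q| ^ 2 * 2 ^ (3 * #|J|)).
Proof.
rewrite -(cardsT {set Q * tracked}) -powersetT card_powerset cardsT /tracked !card_prod card_ffun.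
by rewrite !card_prod card_bool mulnA -[2 * 2 * 2]/(2 ^ 3) -expnM.
Qed.

End Tracking.

(** * Simulation of the game with constant delay by pumped blocks *)

Section Simulation.
Variables (SigmaI SigmaO Q J : finType) (A : streett_cost SigmaI SigmaO Q J).
Variables (x0 : SigmaI) (o0 : SigmaO) (f f' : nat -> nat) (d : nat).
Hypotheses (f'_gt0 : delay_fun f') (d_gt0 : 0 < d).
Hypothesis fE : forall r, block_start f r.+1 = d.*2 + r.
Hypothesis card_d : #|{set Q * tracked Q J}| <= d.
Variable X : (nat -> SigmaO) -> nat -> SigmaI.
Hypothesis causalX : causal f X.

(** The condition sits inside the existential, with a dummy witness for short [u], so that [xchoose]
    yields a total function. *)
Lemma pump_subproof (u : seq SigmaI) (M : nat) :
  exists u', (d <= size u) ==> (M <= size u') && (summary A u' == summary A u).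
Proof.
have [le_du | lt_ud] := leqP d (size u); last by exists [::].
have [u' [le_M eq_u']] :=
  pumping (@summary_cat _ _ _ _ A) M (leq_trans card_d le_du).
by exists u'; rewrite le_M eq_u' eqxx.
Qed.

Definition pump u M := xchoose (pump_subproof u M).

Lemma pumpP u M : size u = d ->
  M <= size (pump u M) /\ summary A (pump u M) = summary A u.
Proof.
move=> sz_u; have /implyP := xchooseP (pump_subproof u M).
by rewrite {1}sz_u leqnn => /(_ isT)/andP[? /eqP].
Qed.

Lemma translate_subproof (q : Q) (u u' : seq SigmaI) (v' : seq SigmaO) :
  exists v, (summary A u' == summary A u) && (size v' == size u') ==>
    (size v == size u) &&
    (foldl (track A) (track0 J q) (zip u v) == foldl (track A) (track0 J q) (zip u' v')).
Proof.
case: eqP => [eq_u | _]; last by exists [::].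
case: eqP => [sz_v' | _]; last by exists [::].
set t := foldl _ _ (zip u' v').
have: (q, t) \in summary A u' by apply/summaryP; exists v'.
by rewrite eq_u => /summaryP[v sz_v eq_t]; exists v; rewrite sz_v eq_t !eqxx.
Qed.

Definition translate q u u' v' := xchoose (translate_subproof q u u' v').

Lemma translateP q u u' v' : summary A u' = summary A u -> size v' = size u' ->
  size (translate q u u' v') = size u /\
  foldl (track A) (track0 J q) (zip u (translate q u u' v')) =
  foldl (track A) (track0 J q) (zip u' v').
Proof.
move=> eq_u sz_v'; have /implyP := xchooseP (translate_subproof q u u' v').
by rewrite {1}eq_u {1}sz_v' !eqxx => /(_ isT)/andP[/eqP ? /eqP ?].
Qed.

(* Before block [i]: the state reached in both plays, Player O's [i] blocks of
   length [d] in the simulated play, the first [i] pumped input blocks, and the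
   pumped input block [i]. *)
Record sim := Sim {
  sim_state : Q;
  sim_out : seq SigmaO;
  sim_past : seq SigmaI;
  sim_next : seq SigmaI }.

Definition sim_in (V : seq SigmaO) (p : nat) : seq SigmaI :=
  segment (X (nth o0 V)) p (p + d).

Definition sim_full (S : sim) := sim_past S ++ sim_next S.

Definition sim_out_next (y : nat -> SigmaO) (S : sim) : seq SigmaO :=
  translate (sim_state S) (sim_in (sim_out S) (size (sim_out S))) (sim_next S)
    (segment y (size (sim_past S)) (size (sim_full S))).

(** If the pumped block starts at position [n], its length alone covers all input that [f'] demands
    up to round [n]. *)
Definition pump_next (V : seq SigmaO) (p n : nat) : seq SigmaI :=
  pump (sim_in V p) (block_start f' n.+1).

(** The next input block is computed from the old [sim_out S]: thanks to the lookahead of [2 d],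
    input block [i.+1] depends only on the first [i] output blocks. *)
Definition sim_step (y : nat -> SigmaO) (S : sim) : sim :=
  {| sim_state := (foldl (track A) (track0 J (sim_state S))
       (zip (sim_next S) (segment y (size (sim_past S)) (size (sim_full S))))).1;
     sim_out := sim_out S ++ sim_out_next y S;
     sim_past := sim_full S;
     sim_next := pump_next (sim_out S) (size (sim_out S) + d) (size (sim_full S)) |}.

Definition sim_init : sim :=
  {| sim_state := qI A; sim_out := [::]; sim_past := [::];
     sim_next := pump_next [::] 0 0 |}.

Definition sim_at (y : nat -> SigmaO) (i : nat) : sim := iter i (sim_step y) sim_init.

Lemma sim_atS y i : sim_at y i.+1 = sim_step y (sim_at y i).
Proof. by []. Qed.

Definition pumped_start y i := size (sim_past (sim_at y i)).
Definition pumped_in y p := nth x0 (sim_past (sim_at y p.+1)) p.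
Definition sim_reply y p := nth o0 (sim_out (sim_at y p.+1)) p.

Lemma size_sim_in V p : size (sim_in V p) = d.
Proof. by rewrite size_segment addKn. Qed.

Lemma size_sim_next y i :
  block_start f' (pumped_start y i).+1 <= size (sim_next (sim_at y i)).
Proof. by case: i => [|i]; apply/(pumpP _ _).1/size_sim_in. Qed.

Lemma pumped_startS y i : pumped_start y i.+1 = pumped_start y i + size (sim_next (sim_at y i)).
Proof. exact: size_cat. Qed.

Lemma pumped_start_lt y i : pumped_start y i < pumped_start y i.+1.
Proof.
rewrite pumped_startS -addn1 leq_add2l (leq_trans _ (size_sim_next y i)) //.
by rewrite block_startS ltn_addl.
Qed.

Lemma eq_sim_at y1 y2 r i : (forall p, p < r -> y1 p = y2 p) ->
  pumped_start y1 i <= r -> sim_at y1 i = sim_at y2 i.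
Proof.
move=> eq_y; elim: i => [_ | i IHi le_r]; first exact: erefl.
have eqS: sim_at y1 i = sim_at y2 i by apply/IHi/leq_trans/le_r/ltnW/pumped_start_lt.
move: le_r; rewrite /pumped_start !sim_atS -eqS /sim_step /sim_out_next.
set S := sim_at y1 i => /= le_r.
suff ->: segment y1 (size (sim_past S)) (size (sim_full S)) =
         segment y2 (size (sim_past S)) (size (sim_full S)) by [].
apply: eq_segment => p /andP[_ lt_p]; apply: eq_y; exact: leq_trans lt_p le_r.
Qed.

Lemma nth_sim_past y i k p : i <= k -> p < pumped_start y i ->
  nth x0 (sim_past (sim_at y k)) p = nth x0 (sim_past (sim_at y i)) p.
Proof.
move=> le_ik lt_p; elim: k le_ik => [|k IHk]; first by rewrite leqn0 => /eqP->.
rewrite leq_eqVlt => /predU1P[-> // | le_ik].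
rewrite sim_atS [sim_past _]/= /sim_full nth_cat IHk //.
by rewrite (leq_trans lt_p) ?(partition_mono (pumped_start_lt y)).
Qed.

Lemma pumped_inE y i p : p < pumped_start y i ->
  pumped_in y p = nth x0 (sim_past (sim_at y i)) p.
Proof.
move=> lt_p; rewrite /pumped_in; case/orP: (leq_total p.+1 i) => [le_pi|le_ip].
  by rewrite [RHS](nth_sim_past le_pi) // (partition_ge (pumped_start_lt y) p.+1).
exact: nth_sim_past.
Qed.

Lemma causal_pumped_in : causal f' pumped_in.
Proof.
move=> r y y' eq_y p lt_p.
have [i /andP[le_ir lt_ri]] := partition_block (s := pumped_start y) erefl (pumped_start_lt y) r.
have eqS := eq_sim_at eq_y le_ir.
(* Blocks [i] and [i.+1] of the pumped input are already fixed by the state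
   before block [i], and this is more lookahead than [f'] asks for. *)
have eqP2: sim_past (sim_at y i.+2) = sim_past (sim_at y' i.+2).
  by rewrite !sim_atS /= /sim_full /= eqS.
have lt_p2: p < pumped_start y i.+2.
  apply: leq_trans lt_p _; rewrite pumped_startS; apply: leq_trans _ (leq_addl _ _).
  apply: leq_trans _ (size_sim_next y i.+1).
  exact: (partition_mono (block_start_lt f'_gt0) (leqW lt_ri)).
rewrite (pumped_inE lt_p2) eqP2; apply/esym/pumped_inE.
by rewrite /pumped_start -eqP2.
Qed.

Lemma segment_pumped_in y i :
  segment (pumped_in y) (pumped_start y i) (pumped_start y i.+1) = sim_next (sim_at y i).
Proof.
have sz: pumped_start y i.+1 - pumped_start y i = size (sim_next (sim_at y i)).
  by rewrite pumped_startS addKn.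
apply: (@eq_from_nth _ x0); first by rewrite size_segment sz.
move=> p; rewrite size_segment => lt_p; rewrite nth_segment //.
rewrite (@pumped_inE _ i.+1); last by rewrite pumped_startS ltn_add2l -sz.
by rewrite sim_atS nth_cat ltnNge leq_addr addKn.
Qed.

Lemma sim_in_causal V V' p : p + d <= d.*2 + size V -> size V <= size V' ->
  (forall r, r < size V -> nth o0 V' r = nth o0 V r) -> sim_in V' p = sim_in V p.
Proof.
move=> le_p le_VV' eqV; apply: eq_segment => r /andP[_ lt_r].
by apply: (causalX eqV); rewrite fE (leq_trans lt_r).
Qed.

Lemma sim_out_nextP y S (V := sim_out S) :
    summary A (sim_next S) = summary A (sim_in V (size V)) ->
  size (sim_out_next y S) = d /\
  foldl (track A) (track0 J (sim_state S))
    (zip (sim_in V (size V)) (sim_out_next y S)) =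
  foldl (track A) (track0 J (sim_state S))
    (zip (sim_next S) (segment y (size (sim_past S)) (size (sim_full S)))).
Proof.
move=> eq_sum; rewrite -(size_sim_in V (size V)); apply: translateP eq_sum _.
by rewrite size_segment size_cat addKn.
Qed.

Lemma sim_invariant y i (S := sim_at y i) (V := sim_out S) :
  size V = d * i /\ summary A (sim_next S) = summary A (sim_in V (size V)).
Proof.
rewrite {}/V {}/S; elim: i => [|i].
  by rewrite muln0; split; last exact/(pumpP _ _).2/size_sim_in.
rewrite sim_atS; set S := sim_at y i => -[sz_out /(sim_out_nextP y)[sz_v _]].
have sz_out': size (sim_out (sim_step y S)) = size (sim_out S) + d.
  by rewrite size_cat sz_v.
rewrite sz_out' mulnSr sz_out; split=> //.
(* The block was pumped before the output was extended; by causality the extension does not change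
   it. *)
rewrite [LHS](pumpP _ _).2 ?size_sim_in // sz_out; congr summary.
apply/esym/sim_in_causal; rewrite ?size_cat ?leq_addr //.
  by rewrite sz_out -addnA addnn addnC.
by move=> r lt_r; rewrite nth_cat lt_r.
Qed.

Lemma size_sim_out y i : size (sim_out (sim_at y i)) = d * i.
Proof. exact: (sim_invariant y i).1. Qed.

Lemma nth_sim_out y i k p : i <= k -> p < d * i ->
  nth o0 (sim_out (sim_at y k)) p = nth o0 (sim_out (sim_at y i)) p.
Proof.
move=> le_ik lt_p; elim: k le_ik => [|k IHk]; first by rewrite leqn0 => /eqP->.
rewrite leq_eqVlt => /predU1P[-> // | le_ik].
rewrite sim_atS [sim_out _]/= nth_cat IHk //.
by rewrite size_sim_out (leq_trans lt_p) // leq_mul2l (le_ik : i <= k) orbT.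
Qed.

Lemma sim_replyE y i p : p < d * i ->
  sim_reply y p = nth o0 (sim_out (sim_at y i)) p.
Proof.
move=> lt_p; rewrite /sim_reply; case/orP: (leq_total p.+1 i) => [le_pi|le_ip].
  by apply/esym/(nth_sim_out y le_pi); rewrite leq_pmull.
exact: nth_sim_out.
Qed.

Lemma segment_sim_reply y i :
  segment (sim_reply y) (d * i) (d * i.+1) = sim_out_next y (sim_at y i).
Proof.
have [_ /(sim_out_nextP y)[sz_v _]] := sim_invariant y i.
have sz: d * i.+1 - d * i = d by rewrite mulnSr addKn.
apply: (@eq_from_nth _ o0); first by rewrite size_segment sz.
move=> p; rewrite size_segment => lt_p; rewrite nth_segment //.
rewrite (@sim_replyE _ i.+1); last by rewrite -ltn_subRL.
by rewrite sim_atS nth_cat size_sim_out ltnNge leq_addr addKn.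
Qed.

Lemma segment_sim_in y i (V := sim_out (sim_at y i)) :
  segment (X (sim_reply y)) (d * i) (d * i.+1) = sim_in V (size V).
Proof.
rewrite /sim_in {}/V size_sim_out -mulnSr; apply: eq_segment => r /andP[_ lt_r].
have eqV p: p < d * i -> sim_reply y p = nth o0 (sim_out (sim_at y i)) p.
  exact: sim_replyE.
apply: (causalX eqV); rewrite fE (leq_trans lt_r) //.
by rewrite mulnSr addnC leq_add2r -addnn leq_addr.
Qed.

(** * From the pumped play back to the simulated one *)

Section Transfer.
Variables (x : nat -> SigmaI) (y : nat -> SigmaO).
Hypothesis eq_x : x =1 pumped_in y.
Let w := outcome (X (sim_reply y)) (sim_reply y).
Let w' := outcome x y.

Lemma segment_pumped_play i :
  segment w' (pumped_start y i) (pumped_start y i.+1) =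
  zip (sim_next (sim_at y i)) (segment y (pumped_start y i) (pumped_start y i.+1)).
Proof.
by rewrite segment_zip -segment_pumped_in (eq_segment (w' := pumped_in y)).
Qed.

(** Tracking starts in the recorded state; [run_state_sim] then shows by induction that both plays
    really reach that state. *)
Lemma foldl_track_sim i (t := track0 J (sim_state (sim_at y i))) :
  foldl (track A) t (segment w (d * i) (d * i.+1)) =
  foldl (track A) t (segment w' (pumped_start y i) (pumped_start y i.+1)).
Proof.
rewrite segment_pumped_play segment_zip segment_sim_reply segment_sim_in.
have [_ /(sim_out_nextP y)[_ ->]] := sim_invariant y i.
by [].
Qed.

Lemma run_state_sim i :
  run_state A w (d * i) = sim_state (sim_at y i) /\
  run_state A w' (pumped_start y i) = sim_state (sim_at y i).
Proof.
elim: i => [|i [IHw IHw']]; first by rewrite muln0.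
rewrite -(track_run_state _ _ (ltnW (pumped_start_lt y i))).
rewrite -(@track_run_state _ _ _ _ A w (d * i)) ?leq_mul2l ?leqnSn ?orbT //.
rewrite /track_run IHw IHw' foldl_track_sim segment_pumped_play sim_atS.
by [].
Qed.

Lemma accepting_sim : accepting A w' -> accepting A w.
Proof.
apply: (@accepting_transfer _ _ _ _ _ _ _ (muln d) (pumped_start y) d).
- exact: muln0.
- by move=> i; rewrite ltn_mul2l d_gt0 ltnSn.
- by move=> i; rewrite mulnSr.
- exact: erefl.
- exact: pumped_start_lt.
move=> i; have [eq_w eq_w'] := run_state_sim i.
by rewrite /track_run eq_w eq_w' foldl_track_sim.
Qed.

End Transfer.

End Simulation.

(** * The equivalence for the given constant delay *)

Lemma constant_block_start f r :
  constant_delay f -> block_start f r.+1 = f 0 + r.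
Proof.
case=> _ f1; rewrite /block_start big_ord_recl; congr (_ + _).
by rewrite (eq_bigr (fun=> 1)) ?sum1_card ?card_ord // => i _; rewrite f1.
Qed.

Theorem theorem3 (SigmaI SigmaO Q J : finType)
  (A : streett_cost SigmaI SigmaO Q J) (n k : nat) (f : nat -> nat) :
  #|Q| = n -> #|J| = k ->
  constant_delay f -> f 0 = 2 ^ (n ^ 4 * 2 ^ (3 * k) + 1) ->
  (playerI_wins f (lang A) <->
   forall f' : nat -> nat, delay_fun f' -> playerI_wins f' (lang A)).
Proof.
move=> cardQ cardJ f_const f0E; split=> [win f' f'_gt0 | win]; last first.
  by apply: win; case: f_const.
have [x0]: inhabited SigmaI.
  case: win => tau [tauP _]; have := f_const.1 0; have := tauP [::].
  by case: (tau _) => [/= <- // | x _ _ _]; exists.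
(* Without output letters there is no output word, so any strategy with blocks of the right length
   wins. *)
have [o0 _ | no_out] := pickP (fun _ : SigmaO => true); last first.
  exists (fun v => nseq (f' (size v)) x0); split=> [v|x y].
    by rewrite size_nseq.
  by have := no_out (y 0).
have [X causalX winX] := playerI_wins_causal f_const.1 (inhabits o0) win.
pose d := 2 ^ (n ^ 4 * 2 ^ (3 * k)).
have d_gt0: 0 < d by rewrite expn_gt0.
have fE r: block_start f r.+1 = d.*2 + r.
  by rewrite constant_block_start // f0E addn1 expnS mul2n.
have card_d: #|{set Q * tracked Q J}| <= d.
  rewrite card_summary cardQ cardJ leq_exp2l // leq_mul2r; apply/orP; right.
  (* The initial state gives [0 < n], hence [n ^ 2 <= n ^ 4]. *)
  by rewrite leq_pexp2l // -cardQ; apply/card_gt0P; exists (qI A).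
apply: (causal_playerI_wins f'_gt0 o0 (causal_pumped_in A x0 o0 f'_gt0 card_d X)).
by move=> x y eq_x /(accepting_sim f'_gt0 d_gt0 fE causalX eq_x)/winX.
Qed.
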